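(* Let $\mathcal{C}$ be a monoidal category and $(P,Q)$ a pivotal pair in $\mathcal{C}$. Then the following is a well-defined monoidal structure on the category $\mathcal{C}(P,Q)$ of $P$ and $Q$ intertwined objects: for objects $(X,\sigma)$ and $(Y,\tau)$, $$(X,\sigma)\otimes(Y,\tau)=\big(X\otimes Y,\ (\sigma\otimes Y)(X\otimes\tau)\big),$$ with monoidal unit $(\mathbf 1,\mathrm{id}_P)$, and with the tensor product of morphisms given by their tensor product in $\mathcal{C}$ (so that the forgetful functor $U:\mathcal{C}(P,Q)\to\mathcal{C}$, $(X,\sigma)\mapsto X$, is strict monoidal).
   Context: Monoidal categories $(\mathcal{C},\otimes,\mathbf 1)$ are assumed strict; object names also denote identity morphisms. A pivotal pair $(P,Q)$ in $\mathcal{C}$ consists of objects $P,Q$ with morphisms $\mathrm{coev}:\mathbf 1\to P\otimes Q$, $\mathrm{ev}:Q\otimes P\to\mathbf 1$ making $Q$ a left dual of $P$, i.e. $(\mathrm{ev}\otimes Q)(Q\otimes\mathrm{coev})=\mathrm{id}_Q$, $(P\otimes\mathrm{ev})(\mathrm{coev}\otimes P)=\mathrm{id}_P$, and morphisms $\underline{\mathrm{coev}}:\mathbf 1\to Q\otimes P$, $\underline{\mathrm{ev}}:P\otimes Q\to\mathbf 1$ making $Q$ a right dual of $P$, i.e. $(\underline{\mathrm{ev}}\otimes P)(P\otimes\underline{\mathrm{coev}})=\mathrm{id}_P$, $(Q\otimes\underline{\mathrm{ev}})(\underline{\mathrm{coev}}\otimes Q)=\mathrm{id}_Q$. The category $\mathcal{C}(P,Q)$: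 objects are pairs $(X,\sigma)$ with $X$ an object of $\mathcal{C}$ and $\sigma:X\otimes P\to P\otimes X$ an invertible morphism such that the two morphisms $$(\mathrm{ev}\otimes X\otimes Q)(Q\otimes\sigma\otimes Q)(Q\otimes X\otimes\mathrm{coev}):Q\otimes X\to X\otimes Q,$$ $$(Q\otimes X\otimes\underline{\mathrm{ev}})(Q\otimes\sigma^{-1}\otimes Q)(\underline{\mathrm{coev}}\otimes X\otimes Q):X\otimes Q\to Q\otimes X$$ are inverse to each other. Morphisms $(X,\sigma)\to(Y,\tau)$ are morphisms $f:X\to Y$ in $\mathcal{C}$ with $\tau(f\otimes P)=(P\otimes f)\sigma$. *)

(* Defs.v *)
(* Plain Rocq: categories are records with Type-valued homs and Leibniz
   equality of morphisms. *)
From Stdlib Require Import ssreflect ProofIrrelevance.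

Set Implicit Arguments.
Unset Strict Implicit.
Unset Printing Implicit Defensive.

Declare Scope cat_scope.
Delimit Scope cat_scope with cat.
#[global] Open Scope cat_scope.

Record category := Category {
  obj :> Type;
  hom : obj -> obj -> Type;
  idm : forall X, hom X X;
  comp : forall X Y Z, hom Y Z -> hom X Y -> hom X Z;
  comp1m : forall X Y (f : hom X Y), comp (idm Y) f = f;
  compm1 : forall X Y (f : hom X Y), comp f (idm X) = f;
  compA : forall X Y Z T (h : hom Z T) (g : hom Y Z) (f : hom X Y),
    comp h (comp g f) = comp (comp h g) f
}.
Arguments hom {c}.
Arguments idm {c}.
Arguments comp {c X Y Z}.

Notation "g ∘ f" := (comp g f) (at level 40, left associativity) : cat_scope.

Definition inverse_morphisms (C : category) (X Y : C)
    (f : hom X Y) (g : hom Y X) : Prop :=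
  g ∘ f = idm X /\ f ∘ g = idm Y.

(* The identity of X seen as a morphism X -> Y when X = Y. The structural
   equalities of objects of a strict monoidal category are propositional, so
   every implicit identification of objects is realized by such a morphism;
   by proof irrelevance it does not depend on the proof of X = Y. *)
Definition idto (C : category) (X Y : C) (e : X = Y) : hom X Y :=
  match e in _ = Z return hom X Z with eq_refl => idm X end.

Record is_strict_monoidal (C : category) (tens : C -> C -> C) (munit : C)
    (tensm : forall {X X' Y Y' : C},
       hom X X' -> hom Y Y' -> hom (tens X Y) (tens X' Y')) : Prop :=
  IsStrictMonoidal {
  tensm_id : forall X Y, tensm (idm X) (idm Y) = idm (tens X Y);
  tensm_comp : forall X X' X'' Y Y' Y''
    (f' : hom X' X'') (f : hom X X') (g' : hom Y' Y'') (g : hom Y Y'),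
    tensm (f' ∘ f) (g' ∘ g) = tensm f' g' ∘ tensm f g;
  tensA_ax : forall X Y Z, tens (tens X Y) Z = tens X (tens Y Z);
  tens1o_ax : forall X, tens munit X = X;
  tenso1_ax : forall X, tens X munit = X;
  tensmA_ax : forall X X' Y Y' Z Z'
    (f : hom X X') (g : hom Y Y') (h : hom Z Z'),
    idto (tensA_ax X' Y' Z') ∘ tensm (tensm f g) h =
    tensm f (tensm g h) ∘ idto (tensA_ax X Y Z);
  tens1m_ax : forall X X' (f : hom X X'),
    idto (tens1o_ax X') ∘ tensm (idm munit) f =
    f ∘ idto (tens1o_ax X);
  tensm1_ax : forall X X' (f : hom X X'),
    idto (tenso1_ax X') ∘ tensm f (idm munit) =
    f ∘ idto (tenso1_ax X)
}.

Record monoidal_category := MonoidalCategory {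
  mcat :> category;
  tens : mcat -> mcat -> mcat;
  munit : mcat;
  tensm : forall X X' Y Y' : mcat,
    hom X X' -> hom Y Y' -> hom (tens X Y) (tens X' Y');
  monoidalP : is_strict_monoidal munit tensm
}.
Arguments tens {m}.
Arguments munit {m}.
Arguments tensm {m X X' Y Y'}.

Notation "X ⊗ Y" := (tens X Y) (at level 38, left associativity) : cat_scope.
Notation "f ⊗m g" := (tensm f g) (at level 38, left associativity) : cat_scope.
Notation "X ◁ f" := (tensm (idm X) f) (at level 38, no associativity) : cat_scope.
Notation "f ▷ X" := (tensm f (idm X)) (at level 38, no associativity) : cat_scope.

Section StructuralIdentities.
Variable C : monoidal_category.
Implicit Types X Y Z : C.

Definition tensA X Y Z : (X ⊗ Y) ⊗ Z = X ⊗ (Y ⊗ Z) :=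
  tensA_ax (monoidalP C) X Y Z.
Definition tens1o X : munit ⊗ X = X := tens1o_ax (monoidalP C) X.
Definition tenso1 X : X ⊗ munit = X := tenso1_ax (monoidalP C) X.

Definition assoc X Y Z : hom ((X ⊗ Y) ⊗ Z) (X ⊗ (Y ⊗ Z)) := idto (tensA X Y Z).
Definition assoc' X Y Z : hom (X ⊗ (Y ⊗ Z)) ((X ⊗ Y) ⊗ Z) :=
  idto (eq_sym (tensA X Y Z)).
Definition lunit X : hom (munit ⊗ X) X := idto (tens1o X).
Definition lunit' X : hom X (munit ⊗ X) := idto (eq_sym (tens1o X)).
Definition runit X : hom (X ⊗ munit) X := idto (tenso1 X).
Definition runit' X : hom X (X ⊗ munit) := idto (eq_sym (tenso1 X)).

End StructuralIdentities.

Record functor (C D : category) := Functor {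
  fobj :> C -> D;
  fmap : forall X Y : C, hom X Y -> hom (fobj X) (fobj Y);
  fmap_id : forall X, fmap (idm X) = idm (fobj X);
  fmap_comp : forall X Y Z (g : hom Y Z) (f : hom X Y),
    fmap (g ∘ f) = fmap g ∘ fmap f
}.

Record is_strict_monoidal_functor (C D : monoidal_category)
    (F : functor C D) : Prop := IsStrictMonoidalFunctor {
  fobj_unit : F munit = munit;
  fobj_tens : forall X Y : C, F (X ⊗ Y) = F X ⊗ F Y;
  fmap_tens : forall (X X' Y Y' : C) (f : hom X X') (g : hom Y Y'),
    idto (fobj_tens X' Y') ∘ fmap F (f ⊗m g) =
    (fmap F f ⊗m fmap F g) ∘ idto (fobj_tens X Y)
}.

(* ucoev and uev are the underlined coevaluation and evaluation, which make Q
   a right dual of P. *)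
Record pivotal_pair (C : monoidal_category) (P Q : C) := PivotalPair {
  coev : hom munit (P ⊗ Q);
  ev : hom (Q ⊗ P) munit;
  ucoev : hom munit (Q ⊗ P);
  uev : hom (P ⊗ Q) munit;
  left_dualQ :
    lunit Q ∘ (ev ▷ Q) ∘ assoc' Q P Q ∘ (Q ◁ coev) ∘ runit' Q = idm Q;
  left_dualP :
    runit P ∘ (P ◁ ev) ∘ assoc P Q P ∘ (coev ▷ P) ∘ lunit' P = idm P;
  right_dualP :
    lunit P ∘ (uev ▷ P) ∘ assoc' P Q P ∘ (P ◁ ucoev) ∘ runit' P = idm P;
  right_dualQ :
    runit Q ∘ (Q ◁ uev) ∘ assoc Q P Q ∘ (ucoev ▷ Q) ∘ lunit' Q = idm Q
}.

Section Intertwined.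
Variables (C : monoidal_category) (P Q : C) (pq : pivotal_pair P Q).
Implicit Types X Y : C.

(* (ev ⊗ X ⊗ Q)(Q ⊗ σ ⊗ Q)(Q ⊗ X ⊗ coev) *)
Definition left_mate X (σ : hom (X ⊗ P) (P ⊗ X)) : hom (Q ⊗ X) (X ⊗ Q) :=
  (lunit X ▷ Q) ∘ ((ev pq ▷ X) ▷ Q) ∘ (assoc' Q P X ▷ Q)
  ∘ ((Q ◁ σ) ▷ Q)
  ∘ (assoc Q X P ▷ Q) ∘ assoc' (Q ⊗ X) P Q ∘ ((Q ⊗ X) ◁ coev pq)
  ∘ runit' (Q ⊗ X).

(* (Q ⊗ X ⊗ uev)(Q ⊗ τ ⊗ Q)(ucoev ⊗ X ⊗ Q), used with τ = σ^-1 *)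
Definition right_mate X (τ : hom (P ⊗ X) (X ⊗ P)) : hom (X ⊗ Q) (Q ⊗ X) :=
  runit (Q ⊗ X) ∘ ((Q ⊗ X) ◁ uev pq) ∘ assoc (Q ⊗ X) P Q ∘ (assoc' Q X P ▷ Q)
  ∘ ((Q ◁ τ) ▷ Q)
  ∘ (assoc Q P X ▷ Q) ∘ ((ucoev pq ▷ X) ▷ Q) ∘ (lunit' X ▷ Q).

Definition is_intertwining X (σ : hom (X ⊗ P) (P ⊗ X)) : Prop :=
  exists σ' : hom (P ⊗ X) (X ⊗ P),
    inverse_morphisms σ σ' /\ inverse_morphisms (left_mate σ) (right_mate σ').

Record intertwined := Intertwined {
  carrier : C;
  braid : hom (carrier ⊗ P) (P ⊗ carrier);
  braidP : is_intertwining braid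
}.

Definition is_intertwiner X Y (σ : hom (X ⊗ P) (P ⊗ X))
    (τ : hom (Y ⊗ P) (P ⊗ Y)) (f : hom X Y) : Prop :=
  τ ∘ (f ▷ P) = (P ◁ f) ∘ σ.

Record intertwiner (A B : intertwined) := Intertwiner {
  underlying : hom (carrier A) (carrier B);
  intertwinerP : is_intertwiner (braid A) (braid B) underlying
}.

Lemma intertwiner_eq (A B : intertwined) (f g : intertwiner A B) :
  underlying f = underlying g -> f = g.
Proof.
case: f g => [f fP] [g gP] /= e; subst g.
by rewrite (proof_irrelevance _ fP gP).
Qed.

Lemma id_intertwiner X (σ : hom (X ⊗ P) (P ⊗ X)) : is_intertwiner σ σ (idm X).
Proof.
by rewrite /is_intertwiner !(tensm_id (monoidalP C)) comp1m compm1.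
Qed.

Lemma comp_intertwiner X Y Z (σ : hom (X ⊗ P) (P ⊗ X))
    (τ : hom (Y ⊗ P) (P ⊗ Y)) (υ : hom (Z ⊗ P) (P ⊗ Z))
    (g : hom Y Z) (f : hom X Y) :
  is_intertwiner τ υ g -> is_intertwiner σ τ f -> is_intertwiner σ υ (g ∘ f).
Proof.
rewrite /is_intertwiner => gP fP.
have -> : (g ∘ f) ▷ P = (g ▷ P) ∘ (f ▷ P).
  by rewrite -(tensm_comp (monoidalP C)) comp1m.
have -> : P ◁ (g ∘ f) = (P ◁ g) ∘ (P ◁ f).
  by rewrite -(tensm_comp (monoidalP C)) comp1m.
by rewrite compA gP -!compA fP.
Qed.

Definition intertwined_id (A : intertwined) : intertwiner A A :=
  Intertwiner (id_intertwiner (braid A)).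

Definition intertwined_comp (A B D : intertwined)
    (g : intertwiner B D) (f : intertwiner A B) : intertwiner A D :=
  Intertwiner (comp_intertwiner (intertwinerP g) (intertwinerP f)).

Definition intertwined_category : category.
Proof.
refine (@Category intertwined intertwiner intertwined_id intertwined_comp
  _ _ _) => *; apply: intertwiner_eq; [exact: comp1m|exact: compm1|exact: compA].
Defined.

Definition forgetful : functor intertwined_category C :=
  @Functor intertwined_category C carrier underlying
    (fun _ => eq_refl) (fun _ _ _ _ _ => eq_refl).

(* (σ ⊗ Y)(X ⊗ τ) *)
Definition tensor_braid X Y (σ : hom (X ⊗ P) (P ⊗ X))
    (τ : hom (Y ⊗ P) (P ⊗ Y)) : hom ((X ⊗ Y) ⊗ P) (P ⊗ (X ⊗ Y)) :=
  assoc P X Y ∘ (σ ▷ Y) ∘ assoc' X P Y ∘ (X ◁ τ) ∘ assoc X Y P.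

(* id_P, through 1 ⊗ P = P = P ⊗ 1 *)
Definition unit_braid : hom (munit ⊗ P) (P ⊗ munit) := runit' P ∘ lunit P.

End Intertwined.

Arguments intertwined_category {C P Q} pq.
Arguments forgetful {C P Q} pq.

(* Main.v *)
From Stdlib Require Import ssreflect ProofIrrelevance.
Require Import Defs.

Set Implicit Arguments.
Unset Strict Implicit.
Unset Printing Implicit Defensive.

(** The mate of (X, σ) is a zigzag: a [coev] opens a pair P, Q to the right of
    X, the strand P crosses X along σ, and [ev] closes it against the incoming
    Q. If σ and τ are crossed one after the other, the mate for X ⊗ Y is a Q
    that passes X and then Y: bend the strand P between the two crossings into
    a zigzag, by the triangle identity of the left duality, and the diagram
    splits as

      left_mate (σ ⊗ τ) = (X ◁ left_mate τ) ∘ (left_mate σ ▷ Y).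

    In the same way the right duality gives

      right_mate (σ ⊗ τ)^-1 = (right_mate σ^-1 ▷ Y) ∘ (X ◁ right_mate τ^-1).

    Both right-hand sides are composites of inverse pairs, hence inverse to
    each other. For the unit, the two mates are the two remaining triangle
    identities. Tensor products of intertwiners intertwine by the interchange
    law, and the associativity and unit laws hold because both sides of each
    have the same carrier and are the same word in the braidings.

    What needs care is that strictness is a family of propositional equalities
    of objects, so that a morphism of the informal text is a composite riddled
    with structural identities. Two devices remove them. The relation [heq]
    (written ≈) is equality of morphisms up to such identities; it is a
    congruence, it erases identities ([heq_castl], [heq_castr]), and between
    morphisms of one type it is equality ([eq_of_heq]). Secondly, every
    generator is replaced by its right-nested whiskering, for instance
    σ : X ⊗ P → P ⊗ X by [cross σ A] : X ⊗ (P ⊗ A) → P ⊗ (X ⊗ A), for all A.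
    In this form diagrams compose without any structural identity, sliding one
    generator past another is naturality in A ([cross_natural], [cup_natural],
    [cap_natural]), and nothing is lost since A may be the unit
    ([cross_faithful]). The splitting of mates above is then the rewriting
    argument of [cross_left_mate_tensor] and [cross_right_mate_tensor]. *)

(** * Equality of morphisms up to structural identities *)

Section Heq.
Variable C : category.
Implicit Types X Y Z : C.

(** The shape of the associativity and unit axioms of a strict monoidal
    category, taken as a relation between morphisms of different types. *)
Definition heq X Y X' Y' (f : hom X Y) (g : hom X' Y') : Prop :=
  exists (eX : X = X') (eY : Y = Y'), idto eY ∘ f = g ∘ idto eX.

Lemma heq_of_eq X Y (f g : hom X Y) : f = g -> heq f g.
Proof. by move=> ->; exists eq_refl, eq_refl; rewrite comp1m compm1. Qed.

Lemma heq_refl X Y (f : hom X Y) : heq f f.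
Proof. exact: heq_of_eq. Qed.

(** Objects need not form a set, yet an equality X = X is erased because its
    proofs are irrelevant. *)
Lemma eq_of_heq X Y (f g : hom X Y) : heq f g -> f = g.
Proof.
move=> [eX [eY]].
rewrite (proof_irrelevance _ eX eq_refl) (proof_irrelevance _ eY eq_refl).
by rewrite comp1m compm1.
Qed.

(** This puts every axiom and every naturality square whose vertical sides are
    structural identities within reach of the calculus of [heq]. *)
Lemma heq_square X Y X' Y' (f : hom X Y) (g : hom X' Y')
    (eX : X = X') (eY : Y = Y') :
  heq f g -> idto eY ∘ f = g ∘ idto eX.
Proof.
move=> [eX' [eY']].
by rewrite (proof_irrelevance _ eX' eX) (proof_irrelevance _ eY' eY).
Qed.

Lemma heq_sym X Y X' Y' (f : hom X Y) (g : hom X' Y') : heq f g -> heq g f.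
Proof.
move=> [eX [eY]]; case: X' / eX g => g; case: Y' / eY g => g.
by rewrite comp1m compm1 => ->; exact: heq_refl.
Qed.

Lemma heq_trans X Y X' Y' X'' Y'' (f : hom X Y) (g : hom X' Y')
  (h : hom X'' Y'') : heq f g -> heq g h -> heq f h.
Proof.
move=> [eX [eY]]; case: X' / eX g => g; case: Y' / eY g => g.
by rewrite comp1m compm1 => ->.
Qed.

Lemma heq_comp X Y Z X' Y' Z' (g : hom Y Z) (f : hom X Y)
    (g' : hom Y' Z') (f' : hom X' Y') :
  heq g g' -> heq f f' -> heq (g ∘ f) (g' ∘ f').
Proof.
move=> [eY [eZ]]; case: Y' / eY g' f' => g' f'; case: Z' / eZ g' => g' hg.
move=> [eX [eY]]; case: X' / eX f' => f'.
rewrite (proof_irrelevance _ eY eq_refl) /= comp1m compm1 => <-.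
by move: hg; rewrite comp1m compm1 => <-; exact: heq_refl.
Qed.

Lemma heq_idto X Y (e : X = Y) : heq (idto e) (idm X).
Proof. by case: Y / e; exact: heq_refl. Qed.

Lemma heq_idm X Y : X = Y -> heq (idm X) (idm Y).
Proof. by move=> ->; exact: heq_refl. Qed.

(** Structural identities disappear on either side. The object W is free
    because the same identity is the identity of its source and of its target,
    and of anything equal to them. *)
Lemma heq_castl X Y Z W X' Y' (c : hom Y Z) (f : hom X Y) (f' : hom X' Y') :
  heq c (idm W) -> heq f f' -> heq (c ∘ f) f'.
Proof.
move=> hc; apply: heq_trans.
case: (hc) => eY _; case: W / eY hc => hc.
have := heq_comp hc (heq_refl f).
by rewrite comp1m.
Qed.

Lemma heq_castr X Y Z W X' Y' (f : hom Y Z) (c : hom X Y) (f' : hom X' Y') :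
  heq c (idm W) -> heq f f' -> heq (f ∘ c) f'.
Proof.
move=> hc; apply: heq_trans.
case: (hc) => _ [eY _]; case: W / eY hc => hc.
have := heq_comp (heq_refl f) hc.
by rewrite compm1.
Qed.

Lemma inverse_comp X Y Z (f : hom X Y) (f' : hom Y X) (g : hom Y Z)
    (g' : hom Z Y) :
  inverse_morphisms f f' -> inverse_morphisms g g' ->
  inverse_morphisms (g ∘ f) (f' ∘ g').
Proof.
move=> [fK f'K] [gK g'K]; split.
- by rewrite -compA (compA g') gK comp1m.
- by rewrite -compA (compA f) f'K comp1m.
Qed.

Lemma inverse_heq X Y X' Y' (f : hom X Y) (g : hom Y X) (f' : hom X' Y')
    (g' : hom Y' X') :
  heq f f' -> heq g g' -> inverse_morphisms f' g' -> inverse_morphisms f g.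
Proof.
move=> hf hg [gf fg]; case: (hf) => eX [eY _].
split; apply: eq_of_heq.
- by apply: heq_trans (heq_comp hg hf) _; rewrite gf; exact: heq_idm.
- by apply: heq_trans (heq_comp hf hg) _; rewrite fg; exact: heq_idm.
Qed.

End Heq.

Notation "f ≈ g" := (heq f g) (at level 70).

Section HeqTensor.
Variable C : monoidal_category.
Implicit Types A B X Y Z W : C.

Lemma heq_tens X Y Z W X' Y' Z' W' (f : hom X Y) (g : hom Z W)
    (f' : hom X' Y') (g' : hom Z' W') :
  f ≈ f' -> g ≈ g' -> f ⊗m g ≈ f' ⊗m g'.
Proof.
move=> [eX [eY]]; case: X' / eX f' => f'; case: Y' / eY f' => f'.
rewrite comp1m compm1 => ->.
move=> [eZ [eW]]; case: Z' / eZ g' => g'; case: W' / eW g' => g'.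
by rewrite comp1m compm1 => ->; exact: heq_refl.
Qed.

Lemma heq_tensA X X' Y Y' Z Z'
    (f : hom X X') (g : hom Y Y') (h : hom Z Z') :
  (f ⊗m g) ⊗m h ≈ f ⊗m (g ⊗m h).
Proof.
by exists (tensA X Y Z), (tensA X' Y' Z'); exact: (tensmA_ax (monoidalP C)).
Qed.

Lemma heq_tens1l X Y (f : hom X Y) : munit ◁ f ≈ f.
Proof.
by exists (tens1o X), (tens1o Y); exact: (tens1m_ax (monoidalP C)).
Qed.

Lemma heq_tens1r X Y (f : hom X Y) : f ▷ munit ≈ f.
Proof.
by exists (tenso1 X), (tenso1 Y); exact: (tensm1_ax (monoidalP C)).
Qed.

Lemma heq_whiskerr X Y A B (f : hom X Y) : (f ▷ A) ▷ B ≈ f ▷ (A ⊗ B).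
Proof. by rewrite -(tensm_id (monoidalP C)); exact: heq_tensA. Qed.

Lemma heq_whiskerl X Y A B (f : hom X Y) : (A ⊗ B) ◁ f ≈ A ◁ (B ◁ f).
Proof. by rewrite -(tensm_id (monoidalP C)); exact: heq_tensA. Qed.

Lemma heq_tens_idm X Y Z W X' Y' (f : hom X Y) (g : hom Z W) :
  f ≈ idm X' -> g ≈ idm Y' -> f ⊗m g ≈ idm (X' ⊗ Y').
Proof. by rewrite -(tensm_id (monoidalP C)); exact: heq_tens. Qed.

Lemma whiskerl_comp X Y Z A (g : hom Y Z) (f : hom X Y) :
  A ◁ (g ∘ f) = (A ◁ g) ∘ (A ◁ f).
Proof. by rewrite -(tensm_comp (monoidalP C)) comp1m. Qed.

Lemma whiskerr_comp X Y Z A (g : hom Y Z) (f : hom X Y) :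
  (g ∘ f) ▷ A = (g ▷ A) ∘ (f ▷ A).
Proof. by rewrite -(tensm_comp (monoidalP C)) comp1m. Qed.

Lemma whisker_exchange X Y Z W (f : hom X Y) (g : hom Z W) :
  (Y ◁ g) ∘ (f ▷ Z) = f ⊗m g.
Proof. by rewrite -(tensm_comp (monoidalP C)) comp1m compm1. Qed.

Lemma whisker_exchange' X Y Z W (f : hom X Y) (g : hom Z W) :
  (f ▷ W) ∘ (X ◁ g) = f ⊗m g.
Proof. by rewrite -(tensm_comp (monoidalP C)) comp1m compm1. Qed.

Lemma assoc_natural X X' Y Y' Z Z'
    (f : hom X X') (g : hom Y Y') (h : hom Z Z') :
  assoc X' Y' Z' ∘ ((f ⊗m g) ⊗m h) = (f ⊗m (g ⊗m h)) ∘ assoc X Y Z.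
Proof. exact: (tensmA_ax (monoidalP C)). Qed.

Lemma assoc'_natural X X' Y Y' Z Z'
    (f : hom X X') (g : hom Y Y') (h : hom Z Z') :
  assoc' X' Y' Z' ∘ (f ⊗m (g ⊗m h)) = ((f ⊗m g) ⊗m h) ∘ assoc' X Y Z.
Proof.
by apply: heq_square; apply: heq_sym; exact: heq_tensA.
Qed.

Lemma inverse_whiskerl X Y Z (f : hom X Y) (g : hom Y X) :
  inverse_morphisms f g -> inverse_morphisms (Z ◁ f) (Z ◁ g).
Proof.
by move=> [gf fg]; split; rewrite -whiskerl_comp ?gf ?fg;
  exact: (tensm_id (monoidalP C)).
Qed.

End HeqTensor.

(* Recognizes whiskered structural identities. *)
Ltac cast := first
  [ exact: heq_idto | exact: heq_refl
  | (apply: heq_tens_idm; cast) ].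

(** * Right-nested whiskering *)

Section NormalForm.
Variable C : monoidal_category.
Implicit Types A B X Y Z W : C.

(** [cross], [cup] and [cap] are locked so that rewriting with associativity
    of composition does not see the structural identities inside them. *)
Definition cross X Y Z W (f : hom (X ⊗ Y) (Z ⊗ W)) A :
    hom (X ⊗ (Y ⊗ A)) (Z ⊗ (W ⊗ A)) :=
  locked (assoc Z W A ∘ (f ▷ A) ∘ assoc' X Y A).

Definition cup X Y (c : hom munit (X ⊗ Y)) A : hom A (X ⊗ (Y ⊗ A)) :=
  locked (assoc X Y A ∘ (c ▷ A) ∘ lunit' A).

Definition cap X Y (c : hom (X ⊗ Y) munit) A : hom (X ⊗ (Y ⊗ A)) A :=
  locked (lunit A ∘ (c ▷ A) ∘ assoc' X Y A).

Lemma heq_cross X Y Z W (f : hom (X ⊗ Y) (Z ⊗ W)) A : cross f A ≈ f ▷ A.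
Proof.
rewrite /cross -lock.
by apply: heq_castr; [cast|]; apply: heq_castl; [cast|]; exact: heq_refl.
Qed.

Lemma heq_cup X Y (c : hom munit (X ⊗ Y)) A : cup c A ≈ c ▷ A.
Proof.
rewrite /cup -lock.
by apply: heq_castr; [cast|]; apply: heq_castl; [cast|]; exact: heq_refl.
Qed.

Lemma heq_cap X Y (c : hom (X ⊗ Y) munit) A : cap c A ≈ c ▷ A.
Proof.
rewrite /cap -lock.
by apply: heq_castr; [cast|]; apply: heq_castl; [cast|]; exact: heq_refl.
Qed.

(** Both sides are f ⊗ h. *)
Lemma cross_natural X Y Z W (f : hom (X ⊗ Y) (Z ⊗ W)) A B (h : hom A B) :
  (Z ◁ (W ◁ h)) ∘ cross f A = cross f B ∘ (X ◁ (Y ◁ h)).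
Proof.
apply: eq_of_heq; apply: (heq_trans (g := f ⊗m h)).
- rewrite -(whisker_exchange f h).
  apply: heq_comp; last exact: heq_cross.
  exact: heq_sym (heq_whiskerl _ _ _).
- rewrite -(whisker_exchange' f h); apply: heq_sym.
  apply: heq_comp; first exact: heq_cross.
  exact: heq_sym (heq_whiskerl _ _ _).
Qed.

Lemma cup_natural X Y (c : hom munit (X ⊗ Y)) A B (h : hom A B) :
  (X ◁ (Y ◁ h)) ∘ cup c A = cup c B ∘ h.
Proof.
apply: eq_of_heq; apply: (heq_trans (g := c ⊗m h)).
- rewrite -(whisker_exchange c h).
  apply: heq_comp; last exact: heq_cup.
  exact: heq_sym (heq_whiskerl _ _ _).
- rewrite -(whisker_exchange' c h); apply: heq_sym.
  apply: heq_comp; first exact: heq_cup.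
  exact: heq_sym (heq_tens1l _).
Qed.

Lemma cap_natural X Y (c : hom (X ⊗ Y) munit) A B (h : hom A B) :
  h ∘ cap c A = cap c B ∘ (X ◁ (Y ◁ h)).
Proof.
apply: eq_of_heq; apply: (heq_trans (g := c ⊗m h)).
- rewrite -(whisker_exchange c h).
  apply: heq_comp; last exact: heq_cap.
  exact: heq_sym (heq_tens1l _).
- rewrite -(whisker_exchange' c h); apply: heq_sym.
  apply: heq_comp; first exact: heq_cap.
  exact: heq_sym (heq_whiskerl _ _ _).
Qed.

Lemma cross_comp X Y Z W S T (g : hom (Z ⊗ W) (S ⊗ T)) (f : hom (X ⊗ Y) (Z ⊗ W))
    A : cross (g ∘ f) A = cross g A ∘ cross f A.
Proof.
apply: eq_of_heq; apply: heq_trans (heq_cross _ _) _.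
rewrite whiskerr_comp; apply: heq_sym.
by apply: heq_comp; exact: heq_cross.
Qed.

Lemma cross_id X Y A : cross (idm (X ⊗ Y)) A = idm (X ⊗ (Y ⊗ A)).
Proof.
apply: eq_of_heq; apply: heq_trans (heq_cross _ _) _.
rewrite (tensm_id (monoidalP C)); apply: heq_idm; exact: tensA.
Qed.

(** Whiskering by the unit does nothing, hence a statement about f may be
    proved for the whiskerings of f. *)
Lemma heq_cross_unit X Y Z W (f : hom (X ⊗ Y) (Z ⊗ W)) : cross f munit ≈ f.
Proof. exact: heq_trans (heq_cross _ _) (heq_tens1r _). Qed.

Lemma cross_faithful X Y Z W X' Y' Z' W' (f : hom (X ⊗ Y) (Z ⊗ W))
    (g : hom (X' ⊗ Y') (Z' ⊗ W')) :
  cross f munit ≈ cross g munit -> f ≈ g.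
Proof.
move=> h; apply: heq_trans (heq_sym (heq_cross_unit f)) _.
exact: heq_trans h (heq_cross_unit g).
Qed.

(** The two triangle identities without structural identities. They are stated
    for any cup and cap, because (P, Q) provides one pair of them as a left
    duality and, with P and Q exchanged, another one as a right duality. *)
Lemma zigzag_capcup P Q (c : hom munit (P ⊗ Q)) (e : hom (Q ⊗ P) munit) A :
  lunit Q ∘ (e ▷ Q) ∘ assoc' Q P Q ∘ (Q ◁ c) ∘ runit' Q = idm Q ->
  cap e (Q ⊗ A) ∘ (Q ◁ cup c A) = idm (Q ⊗ A).
Proof.
move=> /(f_equal (fun f => f ▷ A)); rewrite (tensm_id (monoidalP C)) => <-.
apply: eq_of_heq; rewrite !whiskerr_comp; apply: heq_sym.
apply: heq_castr; [cast|].
apply: heq_comp.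
- apply: heq_castr; [cast|]; apply: heq_castl; [cast|].
  apply: heq_trans (heq_whiskerr _ _ _) (heq_sym (heq_cap _ _)).
- apply: heq_trans (heq_tensA _ _ _) _.
  by apply: heq_tens; [cast | exact: heq_sym (heq_cup _ _)].
Qed.

Lemma zigzag_cupcap P Q (c : hom munit (P ⊗ Q)) (e : hom (Q ⊗ P) munit) A :
  runit P ∘ (P ◁ e) ∘ assoc P Q P ∘ (c ▷ P) ∘ lunit' P = idm P ->
  (P ◁ cap e A) ∘ cup c (P ⊗ A) = idm (P ⊗ A).
Proof.
move=> /(f_equal (fun f => f ▷ A)); rewrite (tensm_id (monoidalP C)) => <-.
apply: eq_of_heq; rewrite !whiskerr_comp; apply: heq_sym.
apply: heq_castr; [cast|].
apply: heq_comp.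
- apply: heq_castr; [cast|]; apply: heq_castl; [cast|].
  apply: heq_trans (heq_tensA _ _ _) _.
  by apply: heq_tens; [cast | exact: heq_sym (heq_cap _ _)].
- apply: heq_trans (heq_whiskerr _ _ _) (heq_sym (heq_cup _ _)).
Qed.

Lemma inverse_cross X Y Z W (f : hom (X ⊗ Y) (Z ⊗ W))
    (g : hom (Z ⊗ W) (X ⊗ Y)) A :
  inverse_morphisms f g -> inverse_morphisms (cross f A) (cross g A).
Proof.
by move=> [gf fg]; split; rewrite -cross_comp ?gf ?fg; exact: cross_id.
Qed.

End NormalForm.

(** * Mates of a tensor product *)

Section Tensor.
Variables (C : monoidal_category) (P Q : C) (pq : pivotal_pair P Q).
Implicit Types A X Y Z : C.

(** The mates as three-step diagrams; all the structural identities in their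
    definitions are absorbed here, once and for all. *)
Lemma cross_left_mate X (σ : hom (X ⊗ P) (P ⊗ X)) A :
  cross (left_mate pq σ) A =
  cap (ev pq) (X ⊗ (Q ⊗ A)) ∘ (Q ◁ cross σ (Q ⊗ A)) ∘
    (Q ◁ (X ◁ cup (coev pq) A)).
Proof.
apply: eq_of_heq; apply: heq_trans (heq_cross _ _) _.
rewrite /left_mate !whiskerr_comp.
apply: heq_castr; [cast|].
apply: heq_comp.
- apply: heq_castr; [cast|]; apply: heq_castr; [cast|].
  apply: heq_comp.
  + apply: heq_castr; [cast|]; apply: heq_castl; [cast|].
    apply: heq_trans (heq_whiskerr _ _ _) _.
    apply: heq_trans (heq_whiskerr _ _ _) (heq_sym (heq_cap _ _)).
  + apply: heq_trans (heq_whiskerr _ _ _) _.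
    apply: heq_trans (heq_tensA _ _ _) _.
    by apply: heq_tens; [cast | exact: heq_sym (heq_cross _ _)].
- apply: heq_trans (heq_tensA _ _ _) _.
  apply: heq_trans (heq_whiskerl _ _ _) _.
  apply: heq_tens; [cast|]; apply: heq_tens; [cast|].
  exact: heq_sym (heq_cup _ _).
Qed.

Lemma cross_right_mate X (τ : hom (P ⊗ X) (X ⊗ P)) A :
  cross (right_mate pq τ) A =
  (Q ◁ (X ◁ cap (uev pq) A)) ∘ (Q ◁ cross τ (Q ⊗ A)) ∘
    cup (ucoev pq) (X ⊗ (Q ⊗ A)).
Proof.
apply: eq_of_heq; apply: heq_trans (heq_cross _ _) _.
rewrite /right_mate !whiskerr_comp.
apply: heq_castr; [cast|].
apply: heq_comp.
- apply: heq_castr; [cast|].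
  apply: heq_comp.
  + apply: heq_castr; [cast|]; apply: heq_castr; [cast|].
    apply: heq_castl; [cast|].
    apply: heq_trans (heq_tensA _ _ _) _.
    apply: heq_trans (heq_whiskerl _ _ _) _.
    apply: heq_tens; [cast|]; apply: heq_tens; [cast|].
    exact: heq_sym (heq_cap _ _).
  + apply: heq_trans (heq_whiskerr _ _ _) _.
    apply: heq_trans (heq_tensA _ _ _) _.
    by apply: heq_tens; [cast | exact: heq_sym (heq_cross _ _)].
- apply: heq_trans (heq_whiskerr _ _ _) _.
  exact: heq_trans (heq_whiskerr _ _ _) (heq_sym (heq_cup _ _)).
Qed.

Definition tensor_braid_inv X Y (σ' : hom (P ⊗ X) (X ⊗ P))
    (τ' : hom (P ⊗ Y) (Y ⊗ P)) : hom (P ⊗ (X ⊗ Y)) ((X ⊗ Y) ⊗ P) :=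
  assoc' X Y P ∘ (X ◁ τ') ∘ assoc X P Y ∘ (σ' ▷ Y) ∘ assoc' P X Y.

Lemma cross_tensor_braid X Y (σ : hom (X ⊗ P) (P ⊗ X))
    (τ : hom (Y ⊗ P) (P ⊗ Y)) A :
  cross (tensor_braid σ τ) A ≈ cross σ (Y ⊗ A) ∘ (X ◁ cross τ A).
Proof.
apply: heq_trans (heq_cross _ _) _.
rewrite /tensor_braid !whiskerr_comp.
apply: heq_castr; [cast|].
apply: heq_comp.
- apply: heq_castr; [cast|]; apply: heq_castl; [cast|].
  exact: heq_trans (heq_whiskerr _ _ _) (heq_sym (heq_cross _ _)).
- apply: heq_trans (heq_tensA _ _ _) _.
  by apply: heq_tens; [cast | exact: heq_sym (heq_cross _ _)].
Qed.

Lemma cross_tensor_braid_inv X Y (σ' : hom (P ⊗ X) (X ⊗ P))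
    (τ' : hom (P ⊗ Y) (Y ⊗ P)) A :
  cross (tensor_braid_inv σ' τ') A ≈ (X ◁ cross τ' A) ∘ cross σ' (Y ⊗ A).
Proof.
apply: heq_trans (heq_cross _ _) _.
rewrite /tensor_braid_inv !whiskerr_comp.
apply: heq_castr; [cast|].
apply: heq_comp.
- apply: heq_castr; [cast|]; apply: heq_castl; [cast|].
  apply: heq_trans (heq_tensA _ _ _) _.
  by apply: heq_tens; [cast | exact: heq_sym (heq_cross _ _)].
- exact: heq_trans (heq_whiskerr _ _ _) (heq_sym (heq_cross _ _)).
Qed.

(** In the composite of the two mates, slide the mate of τ down to the cup of
    the mate of σ. This cup and the cap of the mate of τ then form a zigzag in
    the strand P between the two crossings, which [left_dualP] straightens. *)
Lemma cross_left_mate_tensor X Y (σ : hom (X ⊗ P) (P ⊗ X))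
    (τ : hom (Y ⊗ P) (P ⊗ Y)) A :
  cross (left_mate pq (tensor_braid σ τ)) A ≈
  (X ◁ cross (left_mate pq τ) A) ∘ cross (left_mate pq σ) (Y ⊗ A).
Proof.
apply: (heq_trans (g :=
  (cap (ev pq) (X ⊗ (Y ⊗ (Q ⊗ A))) ∘
   (Q ◁ (cross σ (Y ⊗ (Q ⊗ A)) ∘ (X ◁ cross τ (Q ⊗ A)))) ∘
   (Q ◁ (X ◁ (Y ◁ cup (coev pq) A)))))).
- rewrite cross_left_mate; apply: heq_comp; first apply: heq_comp.
  + by rewrite tensA; exact: heq_refl.
  + by apply: heq_tens; [cast | exact: cross_tensor_braid].
  + by apply: heq_tens; [cast | exact: heq_whiskerl].
- apply: heq_of_eq; rewrite !cross_left_mate !compA.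
  (* Slide the mate of τ past the cap, then past σ, then past the cup. *)
  rewrite cap_natural -!compA; congr (_ ∘ _).
  rewrite -!whiskerl_comp; congr (Q ◁ _).
  rewrite !compA cross_natural -!compA; congr (_ ∘ _).
  rewrite -!whiskerl_comp; congr (X ◁ _).
  rewrite whiskerl_comp -compA cup_natural.
  by rewrite compA (zigzag_cupcap _ (left_dualP pq)) comp1m.
Qed.

(** The mirror image of the previous argument, with the right duality: here
    the cap of the mate of σ' and the cup of the mate of τ' form the zigzag, and
    [right_dualP] straightens it. *)
Lemma cross_right_mate_tensor X Y (σ' : hom (P ⊗ X) (X ⊗ P))
    (τ' : hom (P ⊗ Y) (Y ⊗ P)) A :
  cross (right_mate pq (tensor_braid_inv σ' τ')) A ≈
  cross (right_mate pq σ') (Y ⊗ A) ∘ (X ◁ cross (right_mate pq τ') A).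
Proof.
apply: (heq_trans (g :=
  ((Q ◁ (X ◁ (Y ◁ cap (uev pq) A))) ∘
   (Q ◁ ((X ◁ cross τ' (Q ⊗ A)) ∘ cross σ' (Y ⊗ (Q ⊗ A)))) ∘
   cup (ucoev pq) (X ⊗ (Y ⊗ (Q ⊗ A)))))).
- rewrite cross_right_mate; apply: heq_comp; first apply: heq_comp.
  + by apply: heq_tens; [cast | exact: heq_whiskerl].
  + by apply: heq_tens; [cast | exact: cross_tensor_braid_inv].
  + by rewrite tensA; exact: heq_refl.
- apply: heq_of_eq; rewrite !cross_right_mate -!compA.
  (* Slide the mate of τ' past the cup, then past σ', then past the cap. *)
  rewrite -cup_natural !compA; congr (_ ∘ _).
  rewrite -!whiskerl_comp; congr (Q ◁ _).
  rewrite -!compA -cross_natural !compA; congr (_ ∘ _).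
  rewrite -!whiskerl_comp; congr (X ◁ _).
  rewrite whiskerl_comp compA -cap_natural.
  by rewrite -compA (zigzag_capcup _ (right_dualP pq)) compm1.
Qed.

Lemma inverse_tensor_braid X Y (σ : hom (X ⊗ P) (P ⊗ X))
    (σ' : hom (P ⊗ X) (X ⊗ P)) (τ : hom (Y ⊗ P) (P ⊗ Y))
    (τ' : hom (P ⊗ Y) (Y ⊗ P)) :
  inverse_morphisms σ σ' -> inverse_morphisms τ τ' ->
  inverse_morphisms (tensor_braid σ τ) (tensor_braid_inv σ' τ').
Proof.
move=> hσ hτ.
apply: inverse_heq (heq_sym (heq_cross_unit _)) (heq_sym (heq_cross_unit _)) _.
apply: inverse_heq (cross_tensor_braid _ _ _) (cross_tensor_braid_inv _ _ _) _.
by apply: inverse_comp; [apply: inverse_whiskerl|]; exact: inverse_cross.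
Qed.

Lemma is_intertwining_tensor X Y (σ : hom (X ⊗ P) (P ⊗ X))
    (τ : hom (Y ⊗ P) (P ⊗ Y)) :
  is_intertwining pq σ -> is_intertwining pq τ ->
  is_intertwining pq (tensor_braid σ τ).
Proof.
move=> [σ' [hσ mσ]] [τ' [hτ mτ]]; exists (tensor_braid_inv σ' τ'); split.
  exact: inverse_tensor_braid.
apply: inverse_heq (heq_sym (heq_cross_unit _)) (heq_sym (heq_cross_unit _)) _.
apply: inverse_heq (cross_left_mate_tensor _ _ _)
  (cross_right_mate_tensor _ _ _) _.
by apply: inverse_comp; [|apply: inverse_whiskerl]; exact: inverse_cross.
Qed.

Definition unit_braid_inv : hom (P ⊗ munit) (munit ⊗ P) := lunit' P ∘ runit P.

Lemma heq_unit_braid : unit_braid P ≈ idm P.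
Proof. by apply: heq_castr; cast. Qed.

Lemma heq_unit_braid_inv : unit_braid_inv ≈ idm P.
Proof. by apply: heq_castr; cast. Qed.

Lemma heq_cross_unit_braid A : cross (unit_braid P) A ≈ idm (P ⊗ A).
Proof.
apply: heq_trans (heq_cross _ _) _.
exact: heq_tens_idm heq_unit_braid (heq_refl _).
Qed.

Lemma heq_cross_unit_braid_inv A : cross unit_braid_inv A ≈ idm (P ⊗ A).
Proof.
apply: heq_trans (heq_cross _ _) _.
exact: heq_tens_idm heq_unit_braid_inv (heq_refl _).
Qed.

(** With nothing to cross, the mates are bare zigzags: these are the triangle
    identities for the strand Q. *)
Lemma cross_left_mate_unit A :
  cross (left_mate pq (unit_braid P)) A ≈ idm (Q ⊗ A).
Proof.
rewrite cross_left_mate -(zigzag_capcup A (left_dualQ pq)).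
apply: heq_comp.
- apply: heq_castr.
    exact: heq_tens_idm (heq_refl _) (heq_cross_unit_braid _).
  by rewrite tens1o; exact: heq_refl.
- by apply: heq_tens; [cast | exact: heq_tens1l].
Qed.

Lemma cross_right_mate_unit A :
  cross (right_mate pq unit_braid_inv) A ≈ idm (Q ⊗ A).
Proof.
rewrite cross_right_mate -(zigzag_cupcap A (right_dualQ pq)).
apply: heq_comp.
- apply: heq_castr.
    exact: heq_tens_idm (heq_refl _) (heq_cross_unit_braid_inv _).
  by apply: heq_tens; [cast | exact: heq_tens1l].
- by rewrite tens1o; exact: heq_refl.
Qed.

Lemma inverse_idm (D : category) (X : D) : inverse_morphisms (idm X) (idm X).
Proof. by split; exact: comp1m. Qed.

Lemma is_intertwining_unit : is_intertwining pq (unit_braid P).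
Proof.
exists unit_braid_inv; split.
  exact: inverse_heq heq_unit_braid heq_unit_braid_inv (inverse_idm _).
apply: inverse_heq (heq_sym (heq_cross_unit _)) (heq_sym (heq_cross_unit _)) _.
apply: inverse_heq (cross_left_mate_unit _) (cross_right_mate_unit _) _.
exact: inverse_idm.
Qed.

(** The pair f, g slides first through τ and then through σ. *)
Lemma is_intertwiner_tensor X X' Y Y' (σ : hom (X ⊗ P) (P ⊗ X))
    (σ' : hom (X' ⊗ P) (P ⊗ X')) (τ : hom (Y ⊗ P) (P ⊗ Y))
    (τ' : hom (Y' ⊗ P) (P ⊗ Y')) (f : hom X X') (g : hom Y Y') :
  is_intertwiner σ σ' f -> is_intertwiner τ τ' g ->
  is_intertwiner (tensor_braid σ τ) (tensor_braid σ' τ') (f ⊗m g).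
Proof.
rewrite /is_intertwiner /tensor_braid => hf hg.
have tensE := tensm_comp (monoidalP C).
rewrite -!compA assoc_natural (compA (X' ◁ τ')) -tensE comp1m hg.
rewrite -{1}(compm1 f) tensE -compA (compA (assoc' _ _ _)) assoc'_natural.
rewrite -compA (compA (σ' ▷ Y')) -tensE comp1m hf.
rewrite -{1}(compm1 g) tensE -compA (compA (assoc _ _ _)) assoc_natural.
by rewrite -!compA.
Qed.

(** Both sides are the word σ, τ, υ: the strand P crosses Z, Y and X in turn. *)
Lemma tensor_braidA X Y Z (σ : hom (X ⊗ P) (P ⊗ X))
    (τ : hom (Y ⊗ P) (P ⊗ Y)) (υ : hom (Z ⊗ P) (P ⊗ Z)) :
  tensor_braid (tensor_braid σ τ) υ ≈ tensor_braid σ (tensor_braid τ υ).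
Proof.
apply: cross_faithful.
apply: heq_trans (cross_tensor_braid _ _ _) _.
apply: heq_sym; apply: heq_trans (cross_tensor_braid _ _ _) _.
apply: (heq_trans (g := (cross σ (Y ⊗ (Z ⊗ munit)) ∘
  (X ◁ (cross τ (Z ⊗ munit) ∘ (Y ◁ cross υ munit)))))).
- apply: heq_comp; first by rewrite tensA; exact: heq_refl.
  by apply: heq_tens; [cast | exact: cross_tensor_braid].
- rewrite whiskerl_comp compA; apply: heq_sym; apply: heq_comp.
  + exact: cross_tensor_braid.
  + exact: heq_whiskerl.
Qed.

Lemma tensor_braid1l X (σ : hom (X ⊗ P) (P ⊗ X)) :
  tensor_braid (unit_braid P) σ ≈ σ.
Proof.
apply: cross_faithful.
apply: heq_trans (cross_tensor_braid _ _ _) _.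
apply: heq_castl; [exact: heq_cross_unit_braid | exact: heq_tens1l].
Qed.

Lemma tensor_braid1r X (σ : hom (X ⊗ P) (P ⊗ X)) :
  tensor_braid σ (unit_braid P) ≈ σ.
Proof.
apply: cross_faithful.
apply: heq_trans (cross_tensor_braid _ _ _) _.
apply: heq_castr.
  exact: heq_tens_idm (heq_refl _) (heq_cross_unit_braid _).
by rewrite tens1o; exact: heq_refl.
Qed.

End Tensor.

(** * The category of intertwined objects *)

Section Category.
Variables (C : monoidal_category) (P Q : C) (pq : pivotal_pair P Q).

Lemma intertwined_eq (A B : intertwined pq) :
  carrier A = carrier B -> braid A ≈ braid B -> A = B.
Proof.
case: A B => X σ hσ [Y τ hτ] /= e; case: Y / e τ hτ => τ hτ /eq_of_heq e.
by case: τ / e hτ => hτ; rewrite (proof_irrelevance _ hσ hτ).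
Qed.

Lemma underlying_idto (A B : intertwined_category pq) (e : A = B) :
  underlying (idto e) = idto (f_equal (forgetful pq) e).
Proof. by case: B / e. Qed.

Definition intertwined_tens (A B : intertwined_category pq) :
    intertwined_category pq :=
  Intertwined (is_intertwining_tensor (braidP A) (braidP B)).

Definition intertwined_unit : intertwined_category pq :=
  Intertwined (is_intertwining_unit pq).

Definition intertwined_tensm (A A' B B' : intertwined_category pq)
    (f : hom A A') (g : hom B B') :
    hom (intertwined_tens A B) (intertwined_tens A' B') :=
  @Intertwiner C P Q pq (intertwined_tens A B) (intertwined_tens A' B')
    (underlying f ⊗m underlying g)
    (is_intertwiner_tensor (intertwinerP f) (intertwinerP g)).

Lemma intertwined_strict_monoidal :
  is_strict_monoidal intertwined_unit intertwined_tensm.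
Proof.
unshelve refine (IsStrictMonoidal _ _ _ _ _).
- by move=> A B D; apply: intertwined_eq; [exact: tensA | exact: tensor_braidA].
- by move=> A; apply: intertwined_eq; [exact: tens1o | exact: tensor_braid1l].
- by move=> A; apply: intertwined_eq; [exact: tenso1 | exact: tensor_braid1r].
- by move=> A B; apply: intertwiner_eq; exact: (tensm_id (monoidalP C)).
- by move=> *; apply: intertwiner_eq; exact: (tensm_comp (monoidalP C)).
- move=> A A' B B' D D' f g h; apply: intertwiner_eq => /=.
  by rewrite !underlying_idto; apply: heq_square; exact: heq_tensA.
- move=> A A' f; apply: intertwiner_eq => /=.
  by rewrite !underlying_idto; apply: heq_square; exact: heq_tens1l.
- move=> A A' f; apply: intertwiner_eq => /=.
  by rewrite !underlying_idto; apply: heq_square; exact: heq_tens1r.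
Qed.

End Category.

Theorem theorem4p1 (C : monoidal_category) (P Q : C) (pq : pivotal_pair P Q) :
  exists (tensor_ok : forall A B : intertwined pq,
            is_intertwining pq (tensor_braid (braid A) (braid B)))
         (unit_ok : is_intertwining pq (unit_braid P))
         (tensorm_ok : forall (A A' B B' : intertwined pq)
            (f : intertwiner A A') (g : intertwiner B B'),
            is_intertwiner (tensor_braid (braid A) (braid B))
              (tensor_braid (braid A') (braid B'))
              (underlying f ⊗m underlying g))
         (monoidal : @is_strict_monoidal (intertwined_category pq)
            (fun A B => Intertwined (tensor_ok A B))
            (Intertwined unit_ok)
            (fun A A' B B' f g =>
               @Intertwiner C P Q pq (Intertwined (tensor_ok A B))
                 (Intertwined (tensor_ok A' B'))
                 (underlying f ⊗m underlying g)
                 (tensorm_ok A A' B B' f g))),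
    @is_strict_monoidal_functor (MonoidalCategory monoidal) C (forgetful pq).
Proof.
exists (fun A B => is_intertwining_tensor (braidP A) (braidP B)).
exists (is_intertwining_unit pq).
exists (fun A A' B B' f g =>
  is_intertwiner_tensor (intertwinerP f) (intertwinerP g)).
exists (intertwined_strict_monoidal pq).
unshelve eapply IsStrictMonoidalFunctor; [by [] | by [] |].
by move=> *; rewrite comp1m compm1.
Qed.
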